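(* Let $U\subset\mathbb{C}^n$ be a domain with $C^2$ boundary that is Levi pseudoconvex. Then $U$ is pseudoconvex.
   Context: A domain is a connected open set. A function $f\colon U\to\mathbb{R}$ is an exhaustion function for $U$ if $f^{-1}((-\infty,r])$ is compact for every $r\in\mathbb{R}$. An upper-semicontinuous function $f\colon V\to[-\infty,\infty)$ on an open set $V\subset\mathbb{C}$ is subharmonic if for every closed disc $\overline{B(a,r)}\subset V$ ($r>0$) and every continuous $\phi\colon\overline{B(a,r)}\to\mathbb{R}$ that is harmonic on $B(a,r)$ with $\phi\ge f$ on $\partial B(a,r)$, one has $\phi\ge f$ on $B(a,r)$. An upper-semicontinuous $f\colon V\to[-\infty,\infty)$ on an open $V\subset\mathbb{C}^n$ is plurisubharmonic if for every $a\in V$ and $\delta\in\mathbb{C}^n$ with $|\delta|=1$ the function $z\mapsto f(a+\delta z)$ is subharmonic on $\{z\in\mathbb{C}: a+\delta z\in V\}$. A domain $U\subset\mathbb{C}^n$ is pseudoconvex if it admits a continuous plurisubharmonic exhaustion function $U\to\mathbb{R}$. A local defining function for a domain $U$ at $a\in\partial U$ is a function $f\colon V\to\mathbb{R}$, $V$ an open neighbourhood of $a$, with $U\cap V=f^{-1}((-\infty,0))$. The domain $U$ has $C^2$ boundary if at each $a\in\partial U$ there is a $C^2$ (in the real sense) local defining function whose gradient at $a$ is non-zero. For domains with $C^2$ boundary, all local defining functions at $a$ are required to be $C^2$ with non-zero gradient at $a$, and (after shrinking $V$) to satisfy $\partial U\cap V=f^{-1}(\{0\})$. The complex tangent space at $a$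 with respect to $f$ is $T^c_a(f)=\{\delta\in\mathbb{C}^n:\sum_{j=1}^n\frac{\partial f}{\partial z_j}\big|_a\delta_j=0\}$, and the Levi form is $\Delta_\delta f(a)=\sum_{j,k=1}^n\frac{\partial^2 f}{\partial z_j\partial\overline{z}_k}\big|_a\delta_j\overline{\delta}_k$. A domain $U$ with $C^2$ boundary is Levi pseudoconvex if at every $a\in\partial U$ there is a $C^2$ local defining function $f$ such that $\Delta_\delta f(a)\ge0$ for all $\delta\in T^c_a(f)$. *)

(* Defs.v *)
From HB Require Import structures.
From mathcomp Require Import all_boot all_order all_algebra.
From mathcomp Require Import complex.
From mathcomp Require Import all_classical all_reals all_analysis.

Set Implicit Arguments.
Unset Strict Implicit.
Unset Printing Implicit Defensive.

Import Order.TTheory GRing.Theory Num.Theory.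
Import numFieldNormedType.Exports.

Local Open Scope classical_set_scope.
Local Open Scope ring_scope.

(* [R[i]] with the topology of its (complex-valued) modulus.  Through the
   matrix instances this also equips ['rV[R[i]]_n], i.e. C^n, with the product
   topology; its library norm is the maximum norm, not the Euclidean one. *)
HB.instance Definition _ (R : rcfType) := NormedModule.copy R[i] R[i]^o.

Definition boundary (T : topologicalType) (U : set T) : set T :=
  closure U `\` interior U.

Definition domain (T : topologicalType) (U : set T) : Prop :=
  open U /\ connected U.

(* A function on a set [V] is represented by a total function, of which only
   the values on [V] are ever used. *)

Section RealDerivatives.
Variables (R : realType) (W : normedModType R[i]).

Definition rline (T : Type) (f : W -> T) (a v : W) : R -> T :=
  fun t => f (a + t%:C%C *: v).

Definition rderivable (f : W -> R) (a v : W) : Prop :=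
  derivable (rline f a v) 0 1.

Definition rderive (v : W) (f : W -> R) (a : W) : R :=
  derive1 (rline f a v) 0.

(* [E] is meant to be a real basis of [W], so that the [rderive v], [v] in [E],
   are the real first-order partial derivatives. *)
Fixpoint Ck (E : set W) (k : nat) (V : set W) (f : W -> R) : Prop :=
  {within V, continuous f} /\
  if k is k'.+1 then
    forall v, E v ->
      (forall a, V a -> rderivable f a v) /\ Ck E k' V (rderive v f)
  else True.

Definition cderive (v : W) (g : W -> R[i]) (a : W) : R[i] :=
  Complex (rderive v (fun z => complex.Re (g z)) a)
          (rderive v (fun z => complex.Im (g z)) a).

End RealDerivatives.

Section Subharmonic.
Variable R : realType.

Definition usc (T : topologicalType) (V : set T) (f : T -> \bar R) : Prop :=
  forall a, V a -> f a != +oo%E /\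
    forall r : R, (f a < r%:E)%E -> \forall z \near within V (nbhs a), (f z < r%:E)%E.

Definition laplacian (phi : R[i] -> R) (z : R[i]) : R :=
  rderive (1 : R[i]) (rderive (1 : R[i]) phi) z +
  rderive ('i%C : R[i]) (rderive ('i%C : R[i]) phi) z.

Definition harmonic_on (V : set R[i]) (phi : R[i] -> R) : Prop :=
  Ck [set (1 : R[i]); 'i%C] 2 V phi /\ forall z, V z -> laplacian phi z = 0.

Definition disc (a : R[i]) (r : R) : set R[i] := [set z | `|z - a| < r%:C%C].
Definition cdisc (a : R[i]) (r : R) : set R[i] := [set z | `|z - a| <= r%:C%C].
Definition circle (a : R[i]) (r : R) : set R[i] := [set z | `|z - a| = r%:C%C].

Definition subharmonic (V : set R[i]) (f : R[i] -> \bar R) : Prop :=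
  usc V f /\
  forall (a : R[i]) (r : R), 0 < r -> cdisc a r `<=` V ->
  forall phi : R[i] -> R,
    {within cdisc a r, continuous phi} ->
    harmonic_on (disc a r) phi ->
    (forall z, circle a r z -> (f z <= (phi z)%:E)%E) ->
    forall z, disc a r z -> (f z <= (phi z)%:E)%E.

End Subharmonic.

Section SeveralVariables.
Variables (R : realType) (n : nat).
Local Notation C := R[i].
Local Notation Cn := 'rV[C]_n.

Definition dirx (j : 'I_n) : Cn := delta_mx 0 j.
Definition diry (j : 'I_n) : Cn := 'i%C *: delta_mx 0 j.

Definition enorm (d : Cn) : R :=
  Num.sqrt (\sum_j (complex.Re (d 0 j) ^+ 2 + complex.Im (d 0 j) ^+ 2)).

Definition plurisubharmonic (V : set Cn) (f : Cn -> \bar R) : Prop :=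
  usc V f /\
  forall a d : Cn, V a -> enorm d = 1 ->
    subharmonic [set z : C | V (a + z *: d)] (fun z => f (a + z *: d)).

Definition exhaustion (U : set Cn) (f : Cn -> R) : Prop :=
  forall r : R, compact (U `&` [set z | f z <= r]).

Definition pseudoconvex (U : set Cn) : Prop :=
  exists f : Cn -> R, [/\ {within U, continuous f},
    plurisubharmonic U (fun z => (f z)%:E) & exhaustion U f].

Definition C2 : set Cn -> (Cn -> R) -> Prop := Ck (range dirx `|` range diry) 2.

Definition gradient (f : Cn -> R) (a : Cn) : 'rV[R]_n * 'rV[R]_n :=
  (\row_j rderive (dirx j) f a, \row_j rderive (diry j) f a).

Definition dz (j : 'I_n) (g : Cn -> C) (a : Cn) : C :=
  (cderive (dirx j) g a - 'i%C * cderive (diry j) g a) / 2.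

Definition dzbar (j : 'I_n) (g : Cn -> C) (a : Cn) : C :=
  (cderive (dirx j) g a + 'i%C * cderive (diry j) g a) / 2.

Definition complex_tangent (f : Cn -> R) (a : Cn) : set Cn :=
  [set d | \sum_j dz j (fun z => (f z)%:C%C) a * d 0 j = 0].

Definition levi_form (d : Cn) (f : Cn -> R) (a : Cn) : C :=
  \sum_j \sum_k dz j (dzbar k (fun z => (f z)%:C%C)) a * d 0 j * (d 0 k)^*%C.

Definition local_defining (U : set Cn) (a : Cn) (V : set Cn) (f : Cn -> R) : Prop :=
  [/\ open V, V a & U `&` V = V `&` [set z | f z < 0]].

Definition has_C2_boundary (U : set Cn) : Prop :=
  forall a, boundary U a -> exists (V : set Cn) (f : Cn -> R),
    [/\ local_defining U a V f, C2 V f & gradient f a != 0].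

Definition C2_local_defining (U : set Cn) (a : Cn) (V : set Cn) (f : Cn -> R) : Prop :=
  [/\ local_defining U a V f, C2 V f, gradient f a != 0 &
      boundary U `&` V = V `&` [set z | f z = 0]].

(* The order of [R[i]] makes [0 <= w] say that [w] is real and nonnegative; the
   Levi form of a C^2 function is real, so this is the usual inequality. *)
Definition levi_pseudoconvex (U : set Cn) : Prop :=
  forall a, boundary U a -> exists (V : set Cn) (f : Cn -> R),
    C2_local_defining U a V f /\
    forall d, complex_tangent f a d -> 0 <= levi_form d f a.

End SeveralVariables.

(* Main.v *)
(* Let delta be the distance to the complement of U for the norm of C^n.  The
   exhaustion is max (1 / delta, |z|), and everything reduces to a second-order
   submean inequality for 1 / delta on the four points p + s d with
   s = t, -t, it, -it, up to o(t^2).  If q is a point of the complement nearest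
   to p, put nu = q - p; any choice of complement points q_s gives
   1 / delta (p + s d) >= 1 / |q_s - p - s d|.  Take
   q_s = q + s (d + a nu) + s^2 b nu + o(t^2), so that
   |q_s - p - s d| = |nu| |1 + a s + b s^2| + o(t^2), whose inverse is bounded
   below by the harmonic polynomial Re (1 - a s + (a^2 - b) s^2) / |nu|.  Since
   nu is transversal to the boundary at q, a can be chosen so that d + a nu is a
   complex tangent vector, and then b so as to cancel the pluriharmonic part of
   the second-order term of the defining function along s |-> q_s.  What remains
   of that term is the Levi form, which is nonnegative, so q_s indeed lies
   outside U.  No regularity of delta beyond continuity enters. *)
Require Import Defs.
From HB Require Import structures.
From mathcomp Require Import all_boot all_order all_algebra.
From mathcomp Require Import complex.
From mathcomp Require Import ring lra.
From mathcomp Require Import all_classical all_reals all_analysis.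

Set Implicit Arguments.
Unset Strict Implicit.
Unset Printing Implicit Defensive.

Import Order.TTheory GRing.Theory Num.Theory.
Import numFieldNormedType.Exports.

Local Open Scope classical_set_scope.
Local Open Scope ring_scope.

(** * The norm as a real number *)

Section RealNorm.
Variables (R : realType) (W : normedModType R[i]).
Implicit Types x y : W.

(** The norm of a module over [R[i]] takes its values in [R[i]]. Its real part carries the same
    information and lives in the ordered field [R], where all estimates take place. On C^n it is the
    maximum norm. *)
Definition nrm x : R := complex.Re `|x|.

Lemma nrmE x : `|x| = (nrm x)%:C%C.
Proof. by rewrite /nrm RRe_real // normr_real. Qed.

Lemma nrm_ge0 x : 0 <= nrm x.
Proof. by rewrite -lecR -nrmE normr_ge0. Qed.

Lemma nrm0 : nrm 0 = 0.
Proof. by rewrite /nrm normr0. Qed.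

Lemma nrm_gt0 x : (0 < nrm x) = (x != 0).
Proof. by rewrite -ltcR -nrmE normr_gt0. Qed.

Lemma nrmD x y : nrm (x + y) <= nrm x + nrm y.
Proof. by rewrite -lecR rmorphD /= -!nrmE ler_normD. Qed.

Lemma nrmN x : nrm (- x) = nrm x.
Proof. by rewrite /nrm normrN. Qed.

Lemma nrmC x y : nrm (x - y) = nrm (y - x).
Proof. by rewrite -nrmN opprB. Qed.

Lemma nbhs_nrmP x (P : set W) :
  nbhs x P <-> exists2 e : R, 0 < e & forall y, nrm (y - x) < e -> P y.
Proof.
split.
- case/nbhs_ballP => e /= e0 h.
  have er : e = (complex.Re e)%:C%C by rewrite RRe_real // gtr0_real.
  exists (complex.Re e); first by rewrite -ltcR -er.
  move=> y hy; apply: h; rewrite -ball_normE /= distrC nrmE er ltcR //.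
- case=> e e0 h; apply/nbhs_ballP; exists e%:C%C; first by rewrite /= ltcR.
  by move=> y; rewrite -ball_normE /= distrC nrmE ltcR; exact: h.
Qed.

Lemma continuous_at_nrmP (f : W -> R) x : {for x, continuous f} <->
  forall e : R, 0 < e ->
    exists2 d : R, 0 < d & forall y, nrm (y - x) < d -> `|f y - f x| < e.
Proof.
split.
- move/cvgrPdist_lt => h e e0; have /nbhs_nrmP[d d0 hd] := h _ e0.
  by exists d => // y /hd; rewrite distrC.
- move=> h; apply/cvgrPdist_lt => e e0; apply/nbhs_nrmP.
  by have [d d0 hd] := h _ e0; exists d => // y /hd; rewrite distrC.
Qed.

End RealNorm.

Lemma nrmM (R : realType) (a b : R[i]) : nrm (a * b) = nrm a * nrm b.
Proof. by apply: complexI; rewrite rmorphM /= -!nrmE normrM. Qed.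

Lemma nrmZ (R : realType) (W : normedModType R[i]) (a : R[i]) (x : W) :
  nrm (a *: x) = nrm a * nrm x.
Proof. by apply: complexI; rewrite rmorphM /= -!nrmE normrZ. Qed.

Lemma nrm_real (R : realType) (a : R) : nrm (a%:C%C : R[i]) = `|a|.
Proof. by rewrite /nrm normc_def /= expr0n addr0 sqrtr_sqr. Qed.

Lemma nrm1 (R : realType) : nrm (1 : R[i]) = 1.
Proof. by rewrite /nrm normr1. Qed.

Lemma Re_le_nrm (R : realType) (a : R[i]) : complex.Re a <= nrm a.
Proof.
rewrite /nrm normc_def /=; apply: le_trans (ler_norm _) _.
by rewrite -sqrtr_sqr ler_wsqrtr // lerDl sqr_ge0.
Qed.

(** * First and second derivative tests on the real line *)

Section DerivativeTests.
Variable R : realType.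

Lemma nbhs0P_real (P : set R) :
  nbhs 0 P <-> exists2 e : R, 0 < e & forall t, `|t| < e -> P t.
Proof.
split.
- case/nbhs_ballP => e /= e0 h; exists e => // t ht; apply: h.
  by rewrite -ball_normE /= sub0r normrN.
- case=> e e0 h; apply/nbhs_ballP; exists e => //= t.
  by rewrite -ball_normE /= sub0r normrN; exact: h.
Qed.

Lemma first_derivative_test (g : R -> R) (c : R) :
  is_derive (0:R) (1:R) g c -> 0 < c -> \forall t \near (0:R), 0 < t -> g 0 < g t.
Proof.
move=> [h1 h2] c0; move: h1; rewrite /derivable; set F := (X in cvg (X @ _)) => h1.
have : F h @[h --> 0^'] --> c by rewrite -h2 /derive; exact: h1.
move/cvgrPdist_lt => /(_ _ c0).
rewrite /dnbhs near_withinE; apply: filterS => t + t0.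
rewrite gt_eqF // => /(_ isT).
rewrite /F /= addr0 /GRing.scale /= mulr1 ltr_norml => /andP[_ h].
have : 0 < t^-1 * (g t - g 0) by lra.
by rewrite pmulr_rgt0 ?invr_gt0 // subr_gt0.
Qed.

(** The mean value theorem gives [g t = g 0 + t * dg x] with [0 < x < t], and the first derivative
    test applied to [dg] makes [dg x] positive. *)
Lemma second_derivative_test (g dg : R -> R) (c : R) :
  (\forall t \near (0:R), is_derive (t:R) (1:R) g (dg t)) ->
  dg 0 = 0 -> is_derive (0:R) (1:R) dg c -> 0 < c ->
  \forall t \near (0:R), 0 < t -> g 0 < g t.
Proof.
move=> /nbhs0P_real[e e0 hg] dg0 hdg c0.
have /nbhs0P_real[d d0 hd] := first_derivative_test hdg c0.
apply/nbhs0P_real; exists (Num.min d e); first by rewrite lt_min d0 e0.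
move=> t; rewrite lt_min => /andP[td te] t0.
move: td te; rewrite gtr0_norm // => td te.
have [x xt ->] : exists2 x, x \in `]0, t[ & g t = g 0 + dg x * (t - 0).
  have [x xt h] : exists2 x, x \in `]0, t[ & g t - g 0 = dg x * (t - 0).
    apply: MVT => //.
    - move=> x /itvP hx; apply: hg; rewrite gtr0_norm ?hx //.
      by apply: lt_trans te; rewrite hx.
    - apply: derivable_within_continuous => x /itvP hx.
      have [] // : is_derive x (1:R) g (dg x).
      by apply: hg; rewrite ger0_norm ?hx //; apply: le_lt_trans te; rewrite hx.
  by exists x => //; rewrite -h addrC subrK.
move/itvP : xt => xt; rewrite subr0 ltrDl mulr_gt0 // -dg0 hd ?xt //.
by rewrite gtr0_norm ?xt //; apply: lt_trans td; rewrite xt.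
Qed.

End DerivativeTests.

(** * Continuity of the norm, compact balls and nearest points *)

Section Topology.
Variables (R : realType) (W : normedModType R[i]).

Lemma continuous_lipschitz (g : W -> R) :
  (forall x y, g x <= g y + nrm (x - y)) -> continuous g.
Proof.
move=> h x; apply/continuous_at_nrmP => e e0; exists e => // y; apply: le_lt_trans.
by rewrite ler_norml; have := h x y; have := h y x; rewrite (nrmC x y); lra.
Qed.

Lemma continuous_nrm : continuous (@nrm R W).
Proof.
apply: continuous_lipschitz => x y; rewrite -{1}[x](subrK y) [leRHS]addrC.
exact: nrmD.
Qed.

Lemma continuous_nrmB (p : W) : continuous (fun x : W => nrm (x - p)).
Proof.
apply: continuous_lipschitz => x y; rewrite [leRHS]addrC.
by apply: le_trans (nrmD _ _); rewrite addrA subrK.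
Qed.

Lemma closed_nrm_ball (p : W) (r : R) : closed [set x | nrm (x - p) <= r].
Proof.
apply: (@preimage_closed _ _ (fun x : W => nrm (x - p)) [set y | y <= r]).
  by move=> x _; exact: continuous_nrmB.
exact: closed_le.
Qed.

End Topology.

Section Compact.
Variable R : realType.

Lemma continuous_real_complex : continuous (fun x : R => x%:C%C : R[i]).
Proof.
move=> x P /nbhs_nrmP[e e0 h]; apply/nbhs_ballP; exists e => // y.
rewrite -ball_normE /= distrC => hy; apply: h.
by rewrite -rmorphB nrm_real.
Qed.

(** The disc is a closed subset of the image of the compact square [[-r, r]^2] under
    [(x, y) |-> x + i y]. *)
Lemma compact_nrm_ball_complex (r : R) : compact [set z : R[i] | nrm z <= r].
Proof.
pose f := fun p : R * R => p.1%:C%C + 'i%C * p.2%:C%C : R[i].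
have cf : continuous f.
  move=> p; apply: (@cvgD _ R[i]).
    by apply: cvg_comp; [exact: cvg_fst|exact: continuous_real_complex].
  apply: (@cvgM R[i]); first exact: cvg_cst.
  by apply: cvg_comp; [exact: cvg_snd|exact: continuous_real_complex].
have cK := continuous_compact (continuous_subspaceT cf)
  (compact_setX (@segment_compact _ (- r) r) (@segment_compact _ (- r) r)).
apply: subclosed_compact cK _.
  rewrite (_ : mkset _ = [set z | nrm (z - 0) <= r]); first exact: closed_nrm_ball.
  by apply/seteqP; split => z /=; rewrite subr0.
move=> z /= hz; exists (complex.Re z, complex.Im z); last by rewrite /f -complexE.
have hz' : forall x, x ^+ 2 <= complex.Re z ^+ 2 + complex.Im z ^+ 2 -> x \in `[- r, r].
  move=> x hx; rewrite in_itv /= -ler_norml; apply: le_trans hz.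
  by rewrite /nrm normc_def /= -sqrtr_sqr ler_wsqrtr.
by split => /=; apply: hz'; rewrite ?lerDl ?lerDr sqr_ge0.
Qed.

Lemma nrm_coord n (x : 'rV[R[i]]_n) j : nrm (x 0 j) <= nrm x.
Proof.
rewrite -lecR -!nrmE [leRHS]/Num.norm /= mx_normE.
set b := \big[_/_]_i _; have : (b <= b)%O by [].
by rewrite {1}/b => /bigmax_leP[_ /(_ (0, j) isT)]; rewrite -num_le.
Qed.

Lemma compact_nrm_ball n (p : 'rV[R[i]]_n) (r : R) :
  compact [set x : 'rV[R[i]]_n | nrm (x - p) <= r].
Proof.
have cK := @rV_compact R[i] n (fun=> _)
   (fun=> @compact_nrm_ball_complex (r + nrm p)).
apply: subclosed_compact cK _; first exact: closed_nrm_ball.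
move=> x /= hx i; apply: le_trans (nrm_coord _ _) _.
by rewrite -[x](subrK p); apply: le_trans (nrmD _ _) _; rewrite lerD2r.
Qed.

Lemma nearest_point n (A : set 'rV[R[i]]_n) p : closed A -> A !=set0 ->
  exists2 q, A q & forall q', A q' -> nrm (p - q) <= nrm (p - q').
Proof.
move=> cA [a Aa].
(* Minimising over the points of [A] no farther from [p] than [a] is enough: any other point of [A]
   is beaten by [a] itself. *)
pose K := [set x | nrm (x - p) <= nrm (a - p)] `&` A.
have cK : compact K by apply: compact_closedI => //; exact: compact_nrm_ball.
have [] := @compact_EVT_min _ R (fun x : 'rV[R[i]]_n => nrm (x - p)) K _ cK.
- by exists a; split => //=.
- apply: continuous_subspaceT; exact: continuous_nrmB.
move=> q /set_mem[_ Aq] hq; exists q => // q' Aq'.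
rewrite !(nrmC p).
have [h|h] := leP (nrm (q' - p)) (nrm (a - p)).
  by apply: hq; apply/mem_set.
by apply: le_trans (ltW h); apply: hq; apply/mem_set; split => //=.
Qed.

End Compact.

(** * Restriction to real lines and the four-point submean inequality *)

Section Lines.
Variables (R : realType) (W : normedModType R[i]).

(** Directional derivatives are defined at parameter 0 of a line. Moving the base point along the
    line leaves the difference quotients unchanged, which gives the derivative at every
    parameter. *)
Lemma is_derive_rline (f : W -> R) (a v : W) (t : R) :
  rderivable f (a + t%:C%C *: v) v ->
  is_derive t (1:R) (rline f a v) (rderive v f (a + t%:C%C *: v)).
Proof.
rewrite /rderivable /rderive derive1E.
have e : (fun h : R => h^-1 *: (rline f a v (h *: (1:R) + t) - rline f a v t)) =
  (fun h : R => h^-1 *: (rline f (a + t%:C%C *: v) v (h *: (1:R) + 0) -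
                         rline f (a + t%:C%C *: v) v 0)).
  apply/funext => h; rewrite /rline addr0 scale0r addr0 rmorphD /= scalerDl.
  by congr (_ *: (f _ - _)); rewrite addrA addrAC.
by move=> h; split; rewrite /derivable /derive /= e.
Qed.

Lemma rline0 (f : W -> R) (p v : W) : rline f p v 0 = f p.
Proof. by rewrite /rline scale0r addr0. Qed.

Definition cross_sum (f : W -> R) (p d : W) (t : R) : R :=
  rline f p d t + rline f p d (- t) +
  rline f p ('i%C *: d) t + rline f p ('i%C *: d) (- t).

(** A one-sided asymptotic form of a nonnegative Laplacian of [z |-> f (p + z d)] at 0. It involves
    no derivative of [f], and it passes to maxima. *)
Definition cross_submean (f : W -> R) (p d : W) : Prop :=
  forall e : R, 0 < e ->
    \forall t \near (0 : R), 0 < t -> 4 * f p - e * t ^+ 2 <= cross_sum f p d t.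

End Lines.

(** * Second-order Taylor bounds in one real variable *)

Section Taylor.
Variable R : realType.

(** Subtracting [t * dg 0 + (c / 2 - e) * t ^+ 2] from [g] leaves a function whose first derivative
    at 0 vanishes and whose second derivative there is [2 * e > 0], so the second derivative test
    applies. *)
Lemma taylor2_ge (g dg : R -> R) (c e : R) :
  (\forall t \near (0:R), is_derive (t:R) (1:R) g (dg t)) ->
  is_derive (0:R) (1:R) dg c -> 0 < e ->
  \forall t \near (0:R), 0 < t -> g 0 + t * dg 0 + (c / 2 - e) * t ^+ 2 <= g t.
Proof.
move=> hg hdg e0.
pose k t := g t - t * dg 0 - (c / 2 - e) * t ^+ 2.
pose dk t := dg t - dg 0 - (c - 2 * e) * t.
have hk : \forall t \near (0:R), is_derive (t:R) (1:R) k (dk t).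
  near=> t.
  have h1 : is_derive (t:R) (1:R) g (dg t) by near: t.
  rewrite /k /dk; apply: is_derive_eq.
  rewrite /GRing.scale /=; lra.
have hdk : is_derive (0:R) (1:R) dk (2 * e).
  rewrite /dk; apply: is_derive_eq.
  rewrite /GRing.scale /=; lra.
have := second_derivative_test hk _ hdk _.
rewrite /dk mulr0 !subr0 subrr => /(_ erefl); rewrite mulr_gt0 // => /(_ isT).
apply: filterS => t + t0 => /(_ t0).
rewrite /k mul0r expr0n mulr0 !subr0; lra.
Unshelve. all: by end_near. Qed.

(** This is [taylor2_ge] for [- (g t + g (- t))], whose first derivative at 0 is 0 and whose second
    derivative there is [- (2 * c)]. *)
Lemma symmetric_difference_le (g dg : R -> R) (c e : R) :
  (\forall t \near (0:R), is_derive (t:R) (1:R) g (dg t)) ->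
  is_derive (0:R) (1:R) dg c -> 0 < e ->
  \forall t \near (0:R), 0 < t -> g t + g (- t) <= 2 * g 0 + (c + e) * t ^+ 2.
Proof.
move=> hg hdg e0.
have h1 : \forall t \near (0:R),
    is_derive (t:R) (1:R) (fun t => - (g t + g (- t))) (- (dg t - dg (- t))).
  have hgN : \forall t \near (0:R), is_derive (- t : R) (1:R) g (dg (- t)).
    have /nbhs0P_real[d d0 hd] := hg.
    by apply/nbhs0P_real; exists d => // t ht; apply: hd; rewrite normrN.
  near=> t.
  have h1 : is_derive (t:R) (1:R) g (dg t) by near: t.
  have h2 : is_derive (- t:R) (1:R) g (dg (- t)) by near: t.
  have h3 : is_derive (t:R) (1:R) (fun t => g (- t)) (- dg (- t)).
    apply: (is_derive_eq (is_derive1_comp (g := -%R) h2 (is_deriveNid _ _))).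
    by rewrite mulrN1.
  by apply: is_derive_eq.
have h2 : is_derive (0:R) (1:R) (fun t => - (dg t - dg (- t))) (- (2 * c)).
  have h3 : is_derive (0:R) (1:R) (fun t => dg (- t)) (- c).
    have h4 : is_derive (- 0 : R) (1:R) dg c by rewrite oppr0.
    apply: (is_derive_eq (is_derive1_comp (g := -%R) h4 (is_deriveNid _ _))).
    by rewrite mulrN1.
  apply: is_derive_eq; lra.
apply: filterS (taylor2_ge h1 h2 e0) => t + t0 => /(_ t0).
rewrite oppr0 subrr oppr0; lra.
Unshelve. all: by end_near. Qed.

End Taylor.

(** * A four-point criterion for subharmonicity *)

Section Criterion.
Variable R : realType.
Local Notation C := R[i].

Lemma near_rline (W : normedModType C) (V : set W) (p v : W) :
  open V -> V p -> \forall t \near (0 : R), V (p + t%:C%C *: v).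
Proof.
rewrite openE => oV /oV /nbhs_nrmP[e e0 h].
apply/nbhs0P_real; exists (e / (nrm v + 1)).
  by rewrite divr_gt0 // ltr_wpDl // nrm_ge0.
move=> t; rewrite ltr_pdivlMr ?ltr_wpDl ?nrm_ge0 // => ht.
apply: h; rewrite addrC addKr nrmZ nrm_real.
by apply: le_lt_trans ht; rewrite ler_wpM2l // lerDl.
Qed.

Lemma near_rline_sym (W : normedModType C) (V : set W) (p v : W) : open V -> V p ->
  \forall t \near (0 : R), V (p + t%:C%C *: v) /\ V (p + (- t)%:C%C *: v).
Proof.
move=> oV Vp; have /nbhs0P_real[e e0 h] := near_rline v oV Vp.
by apply/nbhs0P_real; exists e => // t ht; split; apply: h; rewrite ?normrN.
Qed.

Lemma open_disc (a : C) r : open (disc a r).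
Proof.
rewrite (_ : disc a r = (fun z => nrm (z - a)) @^-1` [set y | y < r]).
  by apply: open_comp => [z _|]; [exact: continuous_nrmB|exact: open_lt].
by apply/seteqP; split => z; rewrite /disc /= nrmE ltcR.
Qed.

Lemma rline_second_difference (W : normedModType C) (V : set W) (phi : W -> R)
    (z v : W) (e : R) :
  open V -> V z ->
  (forall a, V a -> rderivable phi a v) ->
  (forall a, V a -> rderivable (rderive v phi) a v) -> 0 < e ->
  \forall t \near (0:R), 0 < t -> rline phi z v t + rline phi z v (- t) <=
     2 * phi z + (rderive v (rderive v phi) z + e) * t ^+ 2.
Proof.
move=> oV Vz h1 h2 e0.
have hg : \forall t \near (0:R),
    is_derive (t : R) (1 : R) (rline phi z v) (rline (rderive v phi) z v t).
  apply: filterS (near_rline v oV Vz) => t /h1 ht.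
  exact: is_derive_rline.
have hdg : is_derive (0:R) (1:R) (rline (rderive v phi) z v)
    (rderive v (rderive v phi) z).
  have h := @is_derive_rline _ _ (rderive v phi) z v 0.
  by rewrite scale0r addr0 in h; exact/h/h2.
have := symmetric_difference_le hg hdg e0.
by rewrite rline0.
Qed.

(** The second differences along 1 and ['i%C] are each controlled up to [e / 2], and the two second
    derivatives add up to the Laplacian, which is 0. *)
Lemma harmonic_cross_sum (V : set C) (phi : C -> R) z e :
  open V -> harmonic_on V phi -> V z -> 0 < e ->
  \forall t \near (0:R), 0 < t -> cross_sum phi z 1 t <= 4 * phi z + e * t ^+ 2.
Proof.
move=> oV [[_ hC] hL] Vz e0.
have [d1 [_ hd1]] := hC 1 (or_introl erefl).
have [d2 [_ hd2]] := hC 'i%C (or_intror erefl).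
have [d11 _] := hd1 1 (or_introl erefl).
have [d22 _] := hd2 'i%C (or_intror erefl).
have e20 : 0 < e / 2 by rewrite divr_gt0.
have := rline_second_difference oV Vz d1 d11 e20.
have := rline_second_difference oV Vz d2 d22 e20.
apply: filterS2 => t + + t0 => /(_ t0) hx /(_ t0) hy.
rewrite /cross_sum (_ : 'i%C *: 1 = 'i%C); last by rewrite /GRing.scale /= mulr1.
have : laplacian phi z * t ^+ 2 = 0 by rewrite hL // mul0r.
by rewrite /laplacian; lra.
Qed.

Lemma cross_sum_sqr (a z : C) t :
  cross_sum (fun w => nrm (w - a) ^+ 2) z 1 t = 4 * nrm (z - a) ^+ 2 + 4 * t ^+ 2.
Proof.
have sq (w : C) : nrm w ^+ 2 = complex.Re w ^+ 2 + complex.Im w ^+ 2.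
  by apply: complexI; rewrite add_Re2_Im2 rmorphXn /= -nrmE.
rewrite /cross_sum /rline !sq; case: z => x y; case: a => u v /=.
by rewrite /GRing.scale /=; simpc => /=; ring.
Qed.

Lemma continuous_usc (W : normedModType C) (V : set W) (f : W -> R) :
  (forall z, V z -> {for z, continuous f}) -> usc V (fun z => (f z)%:E).
Proof.
move=> cf a Va; split => // r; rewrite lte_fin => far.
rewrite near_withinE.
have /continuous_at_nrmP/(_ (r - f a)) := cf _ Va.
rewrite subr_gt0 => /(_ far)[d d0 hd].
apply/nbhs_nrmP; exists d => // y /hd hy _; rewrite lte_fin.
by move: hy; rewrite ltr_norml; lra.
Qed.

(* If f exceeds its harmonic majorant phi inside the disc, then
   f - phi + e |z - a|^2 has an interior maximum for small e > 0; there the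
   four-point sums of f and phi are at least, resp. at most, 4 f and 4 phi up to
   o(t^2), whereas that of e |z - a|^2 exceeds its centre value by 4 e t^2. *)
Lemma subharmonic_cross (V : set C) (f : C -> R) :
  (forall z, V z -> {for z, continuous f}) ->
  (forall z, V z -> cross_submean f z 1) -> subharmonic V (fun z => (f z)%:E).
Proof.
move=> cf hf; split; first exact: continuous_usc.
move=> a r r0 aV phi cphi hphi hle z0 z0a; rewrite lee_fin leNgt; apply/negP => hlt.
have dE w : disc a r w <-> nrm (w - a) < r by rewrite /disc /= nrmE ltcR.
have cE w : cdisc a r w <-> nrm (w - a) <= r by rewrite /cdisc /= nrmE lecR.
have kE w : nrm (w - a) = r -> f w <= phi w.
  by move=> h; rewrite -lee_fin; apply: hle; rewrite /circle /= nrmE h.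
pose m := f z0 - phi z0.
(* With this [e] the perturbation equals [m / 2] on the circle, where [f <= phi], while [k z0 >= m].
   Hence the maximum of [k] cannot lie on the circle. *)
pose e := m / (2 * r ^+ 2).
have m0 : 0 < m by rewrite subr_gt0.
have r20 : 0 < r ^+ 2 by rewrite exprn_gt0.
have e0 : 0 < e by rewrite divr_gt0 // mulr_gt0.
have er : e * r ^+ 2 = m / 2 by rewrite /e; field; rewrite gt_eqF.
pose k w := f w - phi w + e * nrm (w - a) ^+ 2.
have [z1 z1K hz1] : exists2 z1, cdisc a r z1 & forall w, cdisc a r w -> k w <= k z1.
  have ck : {within cdisc a r, continuous k}.
    have c1 : {within cdisc a r, continuous f}.
      by apply: continuous_in_subspaceT => w /set_mem /aV; exact: cf.
    have c2 : {within cdisc a r, continuous (fun w => e * nrm (w - a) ^+ 2)}.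
      apply: continuous_subspaceT => w.
      apply: (@cvgM R C (nbhs w) _ (fun=> e) (fun w => nrm (w - a) ^+ 2)).
        exact: cvg_cst.
      apply: (@continuous_comp C R R (fun w => nrm (w - a)) (fun x => x ^+ 2)).
        exact: continuous_nrmB.
      exact: exprn_continuous.
    by move=> w; apply: cvgD; [apply: cvgB; [exact: c1|exact: cphi]|exact: c2].
  have [] := @compact_EVT_max _ R k (cdisc a r) _ _ ck.
  - by exists a; apply/cE; rewrite subrr nrm0 ltW.
  - rewrite (_ : cdisc a r = [set z | nrm (z - a) <= r]).
      have := @compact_closedI C [set z | nrm z <= r + nrm a] [set z | nrm (z - a) <= r].
      move=> /(_ (@compact_nrm_ball_complex _ _) (@closed_nrm_ball _ _ _ _)).
      congr compact; apply/seteqP; split => [w []//|w /= hw]; split => //=.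
      by rewrite -[w](subrK a); apply: le_trans (nrmD _ _) _; rewrite lerD2r.
    by apply/seteqP; split => w /=; rewrite -cE.
  move=> z1 /set_mem z1K hz1; exists z1 => // w wK; apply: hz1; exact/mem_set.
have hz0 : m <= k z1.
  apply: le_trans (hz1 z0 _); last by apply/cE/ltW/dE.
  by rewrite /k -/m lerDl mulr_ge0 ?sqr_ge0 // ltW.
have Dz1 : disc a r z1.
  apply/dE; rewrite lt_neqAle; move/cE: (z1K) => ->; rewrite andbT.
  apply/eqP => z1r; move: hz0; rewrite leNgt => /negP; apply.
  rewrite /k z1r er; have := kE _ z1r; lra.
have Vz1 : V z1 by apply: aV.
have oD : open (disc a r) by exact: open_disc.
have DK w : disc a r w -> cdisc a r w by move/dE/ltW/cE.
have H : \forall t \near (0:R), ~ (0 < t).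
  near=> t; move=> t0.
  have h1 : 0 < t -> 4 * f z1 - e * t ^+ 2 <= cross_sum f z1 1 t.
    by near: t; exact: (hf _ Vz1 e e0).
  have h2 : 0 < t -> cross_sum phi z1 1 t <= 4 * phi z1 + e * t ^+ 2.
    by near: t; exact: (harmonic_cross_sum oD hphi Dz1 e0).
  have [D1 D2] : disc a r (z1 + t%:C%C *: 1) /\ disc a r (z1 + (- t)%:C%C *: 1).
    by near: t; exact: near_rline_sym.
  have [D3 D4] : disc a r (z1 + t%:C%C *: ('i%C *: 1)) /\
      disc a r (z1 + (- t)%:C%C *: ('i%C *: 1)).
    by near: t; exact: near_rline_sym.
  move: {h1 h2}(h1 t0) (h2 t0) => h1 h2.
  have := congr1 (fun x => e * x) (cross_sum_sqr a z1 t).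
  move: h1 h2 (hz1 _ (DK _ D1)) (hz1 _ (DK _ D2)) (hz1 _ (DK _ D3)) (hz1 _ (DK _ D4)).
  have : 0 < e * t ^+ 2 by rewrite mulr_gt0 // exprn_gt0.
  rewrite /k /cross_sum /rline; lra.
have /nbhs0P_real[d d0 hd] := H.
have d20 : 0 < d / 2 by rewrite divr_gt0.
by apply: (hd (d / 2)) => //; rewrite gtr0_norm //; lra.
Unshelve. all: by end_near. Qed.

End Criterion.

(** * From continuous partial derivatives to Taylor expansion along curves *)

Lemma is_derive0_le (R : realType) (g : R -> R) (L : R) :
  (forall e : R, 0 < e -> \forall t \near (0:R), `|g t - g 0 - t * L| <= e * `|t|) ->
  is_derive (0:R) (1:R) g L.
Proof.
move=> h.
have H : h^-1 *: (g (h *: (1:R) + 0) - g 0) @[h --> (0:R)^'] --> L.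
  apply/cvgrPdist_le => e e0; rewrite /dnbhs near_withinE.
  apply: filterS (h e e0) => t ht t0.
  rewrite addr0 /GRing.scale /= mulr1.
  rewrite (_ : L - _ = - (t^-1 * (g t - g 0 - t * L))); last by field.
  rewrite normrN normrM normfV ler_pdivrMl ?normr_gt0 //.
  by rewrite [leRHS]mulrC.
split; first by apply/cvg_ex; exists L.
exact: cvg_lim H.
Qed.

Lemma is_derive_bigsum (R : realType) (I : Type) (s : seq I) (g : I -> R -> R)
    (dg : I -> R) (x : R) :
  (forall i, is_derive x (1:R) (g i) (dg i)) ->
  is_derive x (1:R) (fun t => \sum_(i <- s) g i t) (\sum_(i <- s) dg i).
Proof.
move=> h; elim: s => [|i s IH].
  under eq_fun do rewrite big_nil.
  by rewrite big_nil; exact: is_derive_cst.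
under eq_fun do rewrite big_cons.
by rewrite big_cons; exact: is_deriveD.
Qed.

Section StrictDerivative.
Variables (R : realType) (W : normedModType R[i]).

Lemma mean_value_rline (f : W -> R) (y v : W) (c L e : R) : 0 <= c ->
  (forall t, 0 <= t <= c -> rderivable f (y + t%:C%C *: v) v /\
     `|rderive v f (y + t%:C%C *: v) - L| <= e) ->
  `|f (y + c%:C%C *: v) - f y - c * L| <= e * c.
Proof.
rewrite le_eqVlt => /predU1P[<- _|c0 h].
  by rewrite scale0r addr0 subrr !(mul0r, mulr0) subrr normr0.
have hd t : t \in `[0, c] ->
    is_derive t (1:R) (rline f y v) (rderive v f (y + t%:C%C *: v)).
  by rewrite in_itv /= => /h[+ _]; exact: is_derive_rline.
have H1 (t : R) : t \in `]0, c[ ->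
    is_derive t (1:R) (rline f y v) (rderive v f (y + t%:C%C *: v)).
  by move=> /subset_itv_oo_cc; exact: hd.
have H2 : {within `[0, c], continuous (rline f y v)}.
  by apply: derivable_within_continuous => t /hd[].
have [x xt] := MVT c0 H1 H2.
rewrite rline0 {1}/rline subr0 => ->.
rewrite mulrC -mulrBr normrM (gtr0_norm c0) mulrC ler_wpM2r //; first exact: ltW.
by have [] := h x; first by move/subset_itv_oo_cc: xt; rewrite in_itv.
Qed.

(** Balls are convex, so the segment between the two points stays where the derivative is close to
    [L], and the mean value estimate applies on it. A negative [c] is handled by exchanging the
    endpoints. *)
Lemma strict_rderive1 (f : W -> R) (x v : W) (L e r : R) :
  (forall z, nrm (z - x) < r -> rderivable f z v /\ `|rderive v f z - L| <= e) ->
  forall (y : W) (c : R), nrm (y - x) < r -> nrm (y + c%:C%C *: v - x) < r ->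
  `|f (y + c%:C%C *: v) - f y - c * L| <= e * `|c|.
Proof.
move=> h.
have key y c : 0 <= c -> nrm (y - x) < r -> nrm (y + c%:C%C *: v - x) < r ->
    `|f (y + c%:C%C *: v) - f y - c * L| <= e * c.
  move=> c0 h1 h2; apply: mean_value_rline => // t /andP[t0 tc]; apply: h.
  have [c00|cn0] := eqVneq c 0.
    by rewrite (_ : t = 0) ?scale0r ?addr0 //; apply/eqP; rewrite eq_le t0 -c00 tc.
  have cgt : 0 < c by rewrite lt_neqAle eq_sym cn0.
  have s01 : 0 <= t / c <= 1 by rewrite divr_ge0 //= ler_pdivrMr // mul1r.
  have -> : y + t%:C%C *: v - x =
     (1 - t / c)%:C%C *: (y - x) + (t / c)%:C%C *: (y + c%:C%C *: v - x).
    rewrite -(addrAC y (- x)) -(addrAC y (- x) (c%:C%C *: v)).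
    set a := y - x; rewrite [_ *: (a + _)]scalerDr rmorphB /= scalerBl scale1r.
    rewrite addrA subrK scalerA.
    by rewrite -rmorphM /= divfK.
  apply: le_lt_trans (nrmD _ _) _.
  rewrite !nrmZ !nrm_real !ger0_norm; [|lra..].
  set X := nrm (y - x) in h1 *; set Y := nrm (y + c%:C%C *: v - x) in h2 *.
  have : (1 - t / c) * X <= (1 - t / c) * Num.max X Y.
    by rewrite ler_wpM2l ?le_max ?lexx //; lra.
  have : t / c * Y <= t / c * Num.max X Y.
    by rewrite ler_wpM2l ?le_max ?lexx ?orbT //; lra.
  have : Num.max X Y < r by rewrite gt_max h1.
  lra.
move=> y c h1 h2; have [c0|c0] := leP 0 c.
  by rewrite (ger0_norm c0); exact: key.
have cN : 0 <= - c by rewrite oppr_ge0 ltW.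
have := key (y + c%:C%C *: v) (- c) cN.
rewrite rmorphN /= scaleNr addrK (ltr0_norm c0) => /(_ h2 h1).
rewrite -normrN => hk.
by rewrite (_ : f _ - _ - _ = - (f y - f (y + c%:C%C *: v) - - c * L)) //; ring.
Qed.

Variables (I : finType) (b : I -> W).

Definition comb (s : seq I) (c : I -> R) : W := \sum_(i <- s) (c i)%:C%C *: b i.

(* The estimate is uniform in the base point y, which is what makes the
   coordinatewise induction go through. *)
Lemma strict_rderive (f : W -> R) (V : set W) (x : W) (e : R) (s : seq I) :
  open V -> V x -> Ck (range b) 1 V f -> 0 < e ->
  exists2 r : R, 0 < r & forall (y : W) (c : I -> R), nrm (y - x) < r ->
    (forall i, `|c i| < r) ->
    `|f (y + comb s c) - f y - \sum_(i <- s) c i * rderive (b i) f x|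
      <= e * \sum_(i <- s) `|c i|.
Proof.
move=> oV Vx [_ hC] e0; elim: s => [|i s [r1 r10 IH]].
  exists 1 => // y c _ _.
  by rewrite /comb !big_nil addr0 !subrr normr0 mulr0.
have [hd [hc _]] := hC (b i) (ex_intro2 _ _ i Logic.I erefl).
have [r2 r20 h2] : exists2 r : R, 0 < r & forall z, nrm (z - x) < r ->
     rderivable f z (b i) /\ `|rderive (b i) f z - rderive (b i) f x| <= e.
  move: (oV); rewrite openE => /(_ _ Vx) /nbhs_nrmP[r0 r00 h0].
  move: hc; rewrite continuous_open_subspace // => /(_ x (mem_set Vx)).
  move/continuous_at_nrmP => /(_ _ e0)[d d0 h].
  exists (Num.min r0 d); first by rewrite lt_min r00.
  move=> z; rewrite lt_min => /andP[/h0 Vz /h zd]; split; [exact: hd|exact: ltW].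
pose r := Num.min r1 r2.
have r0 : 0 < r by rewrite lt_min r10.
have n1 : 0 < 1 + nrm (b i) by rewrite ltr_wpDr // nrm_ge0.
have rr : r / (1 + nrm (b i)) <= r.
  by rewrite ler_pdivrMr // (ler_peMr (ltW r0)) // lerDl nrm_ge0.
(* The factor [1 + nrm (b i)] keeps the shifted base point [y + c i b i], from which the induction
   hypothesis is used, within [r] of [x]. *)
exists (r / (1 + nrm (b i))); first by rewrite divr_gt0.
move=> y c yx cr.
have h3 : nrm (y + (c i)%:C%C *: b i - x) < r.
  rewrite -addrA addrCA addrC; apply: le_lt_trans (nrmD _ _) _.
  rewrite nrmZ nrm_real.
  have /lt_le_trans : nrm (y - x) + `|c i| * nrm (b i) <
      r / (1 + nrm (b i)) * (1 + nrm (b i)).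
    by rewrite mulrDr mulr1 ltr_leD // ler_wpM2r ?nrm_ge0 // ltW.
  by rewrite divfK ?gt_eqF // => h; rewrite h.
have yr : nrm (y - x) < r by apply: lt_le_trans rr.
have := strict_rderive1 h2 (y := y) (c := c i).
have rr1 : r <= r1 by rewrite ge_min lexx.
have rr2 : r <= r2 by rewrite ge_min lexx orbT.
move=> /(_ (lt_le_trans yr rr2) (lt_le_trans h3 rr2)) H1.
have := IH (y + (c i)%:C%C *: b i) c (lt_le_trans h3 rr1)
  (fun j => lt_le_trans (cr j) (le_trans rr rr1)) => H2.
rewrite /comb !big_cons addrA -/(comb s c) mulrDr.
apply: le_trans (lerD H1 H2); apply: le_trans (ler_normD _ _).
by rewrite le_eqVlt; apply/orP; left; apply/eqP; congr (`|_|); ring.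
Qed.

Local Notation lc c := (comb (index_enum I) c).

Lemma CkS k (V : set W) (f : W -> R) : Ck (range b) k.+1 V f -> Ck (range b) k V f.
Proof.
elim: k f => [|k IH] f [h1 h2]; split=> // v /h2[h3 h4]; split => //.
exact: IH.
Qed.

Lemma comb_scale (s : seq I) (t : R) (c : I -> R) :
  comb s (fun i => t * c i) = t%:C%C *: comb s c.
Proof.
rewrite /comb scaler_sumr; apply: eq_bigr => i _.
by rewrite rmorphM /= scalerA.
Qed.

Lemma is_derive_rline_comb (f : W -> R) (V : set W) (x : W) (c : I -> R) :
  open V -> V x -> Ck (range b) 1 V f ->
  is_derive (0:R) (1:R) (rline f x (lc c)) (\sum_i c i * rderive (b i) f x).
Proof.
move=> oV Vx hC; apply: is_derive0_le => e e0.
pose S := \sum_i `|c i|.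
have S0 : 0 <= S by exact: sumr_ge0.
have S1 : 0 < 1 + S by rewrite ltr_wpDr.
have e10 : 0 < e / (1 + S) by rewrite divr_gt0.
have [r r0 h] := strict_rderive (index_enum I) oV Vx hC e10.
apply/nbhs0P_real; exists (r / (1 + S)); first by rewrite divr_gt0.
move=> t; rewrite ltr_pdivlMr // => tr.
have ci i : `|c i| <= S by rewrite /S (bigD1 i) //= lerDl sumr_ge0.
have := h x (fun i => t * c i); rewrite subrr nrm0 => /(_ r0) H.
rewrite rline0 /rline -comb_scale.
rewrite (_ : t * _ = \sum_i (t * c i) * rderive (b i) f x); last first.
  by rewrite mulr_sumr; apply: eq_bigr => i _; rewrite mulrA.
apply: le_trans (H _) _.
  move=> i; apply: le_lt_trans tr; rewrite normrM ler_wpM2l //.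
  by apply: le_trans (ci i) _; rewrite lerDr.
under eq_bigr do rewrite normrM.
rewrite -mulr_sumr -/S mulrCA mulrC ler_wpM2r //.
by rewrite mulrAC ler_pdivrMr // ler_wpM2l ?ltW // ltrDr.
Qed.

Lemma rderive_comb (f : W -> R) (V : set W) (x : W) (c : I -> R) :
  open V -> V x -> Ck (range b) 1 V f ->
  rderivable f x (lc c) /\ rderive (lc c) f x = \sum_i c i * rderive (b i) f x.
Proof.
move=> oV Vx hC; have [h1 h2] := is_derive_rline_comb c oV Vx hC.
by split => //; rewrite /rderive derive1E.
Qed.

(** The second-order bound is applied along the straight line up to [x + t c]. The remaining
    displacement [t^2 d] needs only the first-order estimate, whose uniformity in the base point
    allows it to start from that moving point. Each stage spends [e / 2]. *)
Lemma taylor2_curve (f : W -> R) (V : set W) (x : W) (c d : I -> R) (e : R) :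
  open V -> V x -> Ck (range b) 2 V f -> 0 < e ->
  \forall t \near (0:R), 0 < t ->
    f x + t * (\sum_i c i * rderive (b i) f x) +
    ((\sum_i c i * \sum_j c j * rderive (b j) (rderive (b i) f) x) / 2 +
     \sum_i d i * rderive (b i) f x - e) * t ^+ 2
    <= f (x + t%:C%C *: lc c + (t ^+ 2)%:C%C *: lc d).
Proof.
move=> oV Vx hC e0; have hC1 := CkS hC.
have e20 : 0 < e / 2 by rewrite divr_gt0.
have hg : \forall t \near (0:R), is_derive (t:R) (1:R) (rline f x (lc c))
    (\sum_i c i * rline (rderive (b i) f) x (lc c) t).
  apply: filterS (near_rline (lc c) oV Vx) => t Vt.
  have [h1 h2] := rderive_comb c oV Vt hC1.
  by rewrite -h2; exact: is_derive_rline.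
have hdg : is_derive (0:R) (1:R)
    (fun t => \sum_i c i * rline (rderive (b i) f) x (lc c) t)
    (\sum_i c i * \sum_j c j * rderive (b j) (rderive (b i) f) x).
  apply: is_derive_bigsum => i; apply: is_deriveZ.
  apply: is_derive_rline_comb oV Vx _.
  by have [_ h] := hC; have [] := h (b i) (ex_intro2 _ _ i Logic.I erefl).
pose S := \sum_i `|d i|.
have S0 : 0 <= S by exact: sumr_ge0.
have S1 : 0 < 1 + S by rewrite ltr_wpDr.
have e10 : 0 < e / 2 / (1 + S) by rewrite divr_gt0.
have [r r0 h] := strict_rderive (index_enum I) oV Vx hC1 e10.
(* For [t < 1], the bound [t * K < r] controls both the displacement [t c] of the base point and the
   coefficients [t^2 d i]. *)
pose K := 1 + nrm (lc c) + S.
have K0 : 0 < K by rewrite ltr_wpDr // ltr_wpDr // nrm_ge0.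
have hsmall : \forall t \near (0:R), `|t| < Num.min 1 (r / K).
  by apply/nbhs0P_real; exists (Num.min 1 (r / K)) => //; rewrite lt_min ltr01 divr_gt0.
have := taylor2_ge hg hdg e20; move: hsmall; apply: filterS2 => t.
rewrite lt_min ltr_pdivlMr // => /andP[t1 tK] + t0 => /(_ t0).
move: t1 tK; rewrite gtr0_norm // => t1 tK.
rewrite rline0; under eq_bigr do rewrite rline0.
set D := \sum_i _; set H := \sum_i c i * _; rewrite /rline => h1.
have := h (x + t%:C%C *: lc c) (fun i => t ^+ 2 * d i).
rewrite addrAC subrr add0r nrmZ nrm_real gtr0_norm //.
have -> : (\sum_i t ^+ 2 * d i * rderive (b i) f x) =
    t ^+ 2 * \sum_i d i * rderive (b i) f x.
  by rewrite mulr_sumr; apply: eq_bigr => i _; rewrite mulrA.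
have -> : \sum_i `|t ^+ 2 * d i| = t ^+ 2 * S.
  rewrite mulr_sumr; apply: eq_bigr => i _.
  by rewrite normrM ger0_norm // sqr_ge0.
rewrite comb_scale; set G := \sum_i d i * _ => h2.
have {h2} : f (x + t%:C%C *: lc c) + t ^+ 2 * G - (e / 2 / (1 + S)) * (t ^+ 2 * S)
    <= f (x + t%:C%C *: lc c + (t ^+ 2)%:C%C *: lc d).
  have := h2 _ _; rewrite ler_norml => h3.
  have /andP[h4 _] : - (e / 2 / (1 + S) * (t ^+ 2 * S)) <=
      f (x + t%:C%C *: lc c + (t ^+ 2)%:C%C *: lc d) - f (x + t%:C%C *: lc c) - t ^+ 2 * G
      <= e / 2 / (1 + S) * (t ^+ 2 * S).
    apply: h3.
    - apply: le_lt_trans tK; rewrite ler_wpM2l ?ltW //.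
      by rewrite /K; have := nrm_ge0 (lc c); lra.
    - move=> i; apply: le_lt_trans tK; rewrite normrM ger0_norm ?sqr_ge0 //.
      rewrite expr2 -mulrA ler_wpM2l ?ltW //.
      have di : `|d i| <= S by rewrite /S (bigD1 i) //= lerDl sumr_ge0.
      have : t * `|d i| <= 1 * `|d i| by rewrite ler_wpM2r // ltW.
      by rewrite /K mul1r; have := nrm_ge0 (lc c); lra.
  by move: h4; lra.
have : e / 2 / (1 + S) * (t ^+ 2 * S) <= e / 2 * t ^+ 2.
  rewrite mulrCA [leRHS]mulrC ler_wpM2l ?sqr_ge0 //.
  by rewrite mulrAC ler_pdivrMr // ler_wpM2l ?ltW // ltrDr.
by move: h1; lra.
Qed.

End StrictDerivative.

(** * Complex derivatives: the differential, the Hessian and the Levi form *)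

Lemma complex_half (R : realType) (x y : R) :
  Complex x y / 2 = Complex (x / 2) (y / 2).
Proof.
have h : (2 : R[i]) != 0 by rewrite pnatr_eq0.
apply: (mulIf h); rewrite divfK // mulr_natr mulr2n.
by apply/eqP; rewrite eq_complex /= -!splitr !eqxx.
Qed.

Lemma complex_subi (R : realType) (x y u v : R) :
  Complex x y - 'i%C * Complex u v = Complex (x + v) (y - u).
Proof. by apply/eqP; rewrite eq_complex /=; apply/andP; split; apply/eqP; ring. Qed.

Lemma complex_addi (R : realType) (x y u v : R) :
  Complex x y + 'i%C * Complex u v = Complex (x - v) (y + u).
Proof. by apply/eqP; rewrite eq_complex /=; apply/andP; split; apply/eqP; ring. Qed.

Lemma big_sum_sum (R : realType) (J : finType) (F : J + J -> J + J -> R) :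
  \sum_i \sum_j F i j = \sum_j \sum_k
    (F (inl k) (inl j) + F (inr k) (inl j) + F (inl k) (inr j) + F (inr k) (inr j)).
Proof.
rewrite exchange_big big_sumType /= -big_split; apply: eq_bigr => j _.
rewrite /= 2!big_sumType /= -!big_split; apply: eq_bigr => k _ /=.
by rewrite !addrA.
Qed.

(** [A], [B], [A'], [B'] stand for the second derivatives of [f] along [x_j x_k], [x_j y_k],
    [y_j x_k], [y_j y_k], and the complex coefficient for the mixed derivative in [z_j] and the
    conjugate of [z_k]. Adding the values at [v, w] and at [i v, i w] cancels the part of the
    Hessian that is complex bilinear or its conjugate. *)
Lemma levi_term (R : realType) (v w : R[i]) (A B A' B' : R) :
  4 * complex.Re (Complex ((A + B') / 4) ((B - A') / 4) * v * w^*%C) =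
  (complex.Re v * complex.Re w * A + complex.Re v * complex.Im w * B +
   complex.Im v * complex.Re w * A' + complex.Im v * complex.Im w * B') +
  (complex.Re ('i%C * v) * complex.Re ('i%C * w) * A +
   complex.Re ('i%C * v) * complex.Im ('i%C * w) * B +
   complex.Im ('i%C * v) * complex.Re ('i%C * w) * A' +
   complex.Im ('i%C * v) * complex.Im ('i%C * w) * B').
Proof. by case: v w => x y [x' y'] /=; field. Qed.

Section ComplexDerivatives.
Variables (R : realType) (n : nat).
Local Notation C := R[i].
Local Notation Cn := 'rV[C]_n.
Local Notation I := ('I_n + 'I_n)%type.

Definition rbasis (i : I) : Cn :=
  match i with inl j => dirx R j | inr j => diry R j end.

Definition rcoord (v : Cn) (i : I) : R :=
  match i with inl j => complex.Re (v 0 j) | inr j => complex.Im (v 0 j) end.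

Lemma comb_rcoord (v : Cn) : comb rbasis (index_enum I) (rcoord v) = v.
Proof.
rewrite /comb big_sumType /= -big_split /= [RHS]row_sum_delta.
apply: eq_bigr => j _; rewrite /dirx /diry scalerA -scalerDl mulrC.
by rewrite -complexE.
Qed.

Lemma C2_rbasis (V : set Cn) f : C2 V f -> Ck (range rbasis) 2 V f.
Proof.
congr Ck; apply/seteqP; split => v.
  by case=> -[j _ <-]; [exists (inl j)|exists (inr j)].
by case=> -[j|j] _ <-; [left|right]; exists j.
Qed.

Variables (f : Cn -> R) (q : Cn).

(** The real differential of [f] at [q]. Below it, [hess] is the real Hessian as a quadratic form,
    and [cform] is the (1,0)-part of the differential, whose kernel is the complex tangent space. *)
Definition dform (v : Cn) : R := \sum_i rcoord v i * rderive (rbasis i) f q.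

Definition hess (v : Cn) : R := \sum_i rcoord v i *
  \sum_j rcoord v j * rderive (rbasis j) (rderive (rbasis i) f) q.

Definition cform (v : Cn) : C := \sum_j dz j (fun z => (f z)%:C%C) q * v 0 j.

Lemma cformD v w : cform (v + w) = cform v + cform w.
Proof.
by rewrite /cform -big_split; apply: eq_bigr => j _; rewrite mxE mulrDr.
Qed.

Lemma cformZ a v : cform (a *: v) = a * cform v.
Proof.
by rewrite /cform mulr_sumr; apply: eq_bigr => j _; rewrite mxE mulrCA.
Qed.

Lemma rderive_cst (v : Cn) (k : R) a : rderive v (fun=> k) a = 0.
Proof. by rewrite /rderive derive1_cst. Qed.

Lemma dz_real j : dz j (fun z => (f z)%:C%C) q =
  Complex (rderive (dirx R j) f q / 2) (- (rderive (diry R j) f q / 2)).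
Proof.
rewrite /dz /cderive /= !rderive_cst.
by rewrite complex_subi complex_half addr0 sub0r mulNr.
Qed.

Lemma dzbar_real j a : dzbar j (fun z => (f z)%:C%C) a =
  Complex (rderive (dirx R j) f a / 2) (rderive (diry R j) f a / 2).
Proof.
rewrite /dzbar /cderive /= !rderive_cst.
by rewrite complex_addi complex_half subr0 add0r.
Qed.

Lemma Re_sum (J : Type) (s : seq J) (F : J -> C) :
  complex.Re (\sum_(j <- s) F j) = \sum_(j <- s) complex.Re (F j).
Proof. by apply: big_morph => // -[? ?] [? ?]. Qed.

Lemma dform_Re v : dform v = 2 * complex.Re (cform v).
Proof.
rewrite /dform /cform Re_sum big_sumType /= -big_split mulr_sumr /=.
apply: eq_bigr => j _; rewrite dz_real; case: (v 0 j) => x y /=.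
by move: (rderive (dirx R j) f q) (rderive (diry R j) f q) => A B; field.
Qed.

Lemma dformD v w : dform (v + w) = dform v + dform w.
Proof. by rewrite !dform_Re cformD raddfD mulrDr. Qed.

Lemma dformZ (t : R) v : dform (t%:C%C *: v) = t * dform v.
Proof. by rewrite !dform_Re cformZ; case: (cform v) => x y /=; ring. Qed.

Lemma dform_gt0 : gradient f q != 0 -> exists v, 0 < dform v.
Proof.
(* The gradient read as a vector of C^n: on it the differential is the sum of the squared partial
   derivatives. *)
move=> g0; pose v : Cn := \row_j Complex (rderive (dirx R j) f q) (rderive (diry R j) f q).
exists v.
have -> : dform v = \sum_i rderive (rbasis i) f q ^+ 2.
  by apply: eq_bigr => -[j|j] _; rewrite /= mxE.
rewrite lt_neqAle sumr_ge0 ?andbT; last by move=> i _; rewrite sqr_ge0.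
apply: contra g0; rewrite eq_sym => /eqP h0.
have h i : rderive (rbasis i) f q = 0.
  apply/eqP; rewrite -sqrf_eq0; apply/eqP.
  by apply: (psumr_eq0P _ h0) => // j _; exact: sqr_ge0.
apply/eqP; congr pair; apply/rowP => j; rewrite !mxE.
  exact: (h (inl j)).
exact: (h (inr j)).
Qed.

Lemma rderive_half (g : Cn -> R) (v : Cn) :
  rderivable g q v -> rderive v (fun z => g z / 2) q = rderive v g q / 2.
Proof.
rewrite /rderivable /rderive !derive1E => h.
rewrite (_ : rline (fun z => g z / 2) q v = 2^-1 \*: rline g q v).
  by rewrite deriveZ //= mulrC.
by apply/funext => t; rewrite /rline /= mulrC.
Qed.

Lemma hessE v : hess v = \sum_j \sum_k
  (complex.Re (v 0 j) * complex.Re (v 0 k) * rderive (dirx R j) (rderive (dirx R k) f) q +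
   complex.Re (v 0 j) * complex.Im (v 0 k) * rderive (dirx R j) (rderive (diry R k) f) q +
   complex.Im (v 0 j) * complex.Re (v 0 k) * rderive (diry R j) (rderive (dirx R k) f) q +
   complex.Im (v 0 j) * complex.Im (v 0 k) * rderive (diry R j) (rderive (diry R k) f) q).
Proof.
transitivity (\sum_i \sum_j rcoord v j * rcoord v i *
    rderive (rbasis j) (rderive (rbasis i) f) q).
  apply: eq_bigr => i _; rewrite mulr_sumr; apply: eq_bigr => j _.
  by rewrite mulrCA mulrA.
exact: big_sum_sum.
Qed.

(* An identity between the unsymmetrised sums of second derivatives, so that
   Schwarz's theorem is not involved. *)
Lemma levi_form_hess v :
  (forall i j, rderivable (rderive (rbasis i) f) q (rbasis j)) ->
  4 * complex.Re (levi_form v f q) = hess v + hess ('i%C *: v).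
Proof.
move=> hd; rewrite !hessE /levi_form Re_sum -big_split mulr_sumr.
apply: eq_bigr => j _; rewrite Re_sum -big_split mulr_sumr.
apply: eq_bigr => k _.
rewrite (_ : dz j _ q = Complex
   ((rderive (dirx R j) (rderive (dirx R k) f) q +
     rderive (diry R j) (rderive (diry R k) f) q) / 4)
   ((rderive (dirx R j) (rderive (diry R k) f) q -
     rderive (diry R j) (rderive (dirx R k) f) q) / 4)); last first.
  rewrite (_ : dzbar k _ = fun z =>
    Complex (rderive (dirx R k) f z / 2) (rderive (diry R k) f z / 2)); last first.
    by apply/funext => z; rewrite dzbar_real.
  rewrite /dz /cderive /=.
  rewrite complex_subi complex_half.
  have half (x y X Y : R) : x = X / 2 -> y = Y / 2 -> (x + y) / 2 = (X + Y) / 4.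
    by move=> -> ->; field.
  have halfN (x y X Y : R) : x = X / 2 -> y = Y / 2 -> (x - y) / 2 = (X - Y) / 4.
    by move=> -> ->; field.
  congr Complex.
  - by apply: half; [exact: (rderive_half (hd (inl k) (inl j)))
                    |exact: (rderive_half (hd (inr k) (inr j)))].
  - by apply: halfN; [exact: (rderive_half (hd (inr k) (inl j)))
                     |exact: (rderive_half (hd (inl k) (inr j)))].
rewrite !mxE; exact: levi_term.
Qed.

End ComplexDerivatives.

(** * The inverse modulus of a quadratic perturbation of 1 *)

Section Scalar.
Variable R : realType.
Local Notation C := R[i].

(** The polynomial [m = 1 - a t + (a^2 - b) t^2] inverts [1 + a t + b t^2] up to third order. So
    [mu * m] is 1 plus terms in [t^3] and [t^4] plus [e t^2 m], and the real part of [m] is at most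
    its modulus. *)
Lemma inv_nrm_ge (a : C) (b e : R) : 0 < e ->
  \forall t \near (0:R), 0 < t -> forall mu : C,
  mu = 1 + t%:C%C * a + (t ^+ 2 * (b + e))%:C%C -> mu != 0 ->
  1 - t * complex.Re a + (complex.Re (a ^+ 2) - b) * t ^+ 2 - 6 * e * t ^+ 2
    <= (nrm mu)^-1.
Proof.
move=> e0.
pose B' : C := a ^+ 2 - b%:C%C; pose A := nrm a; pose B := nrm B'.
(* The coefficients of [t^3] and [t^4] in [(1 + a t + b t^2) m]; those of [t] and [t^2] vanish. *)
pose c3 : C := a * B' - a * b%:C%C; pose c4 : C := b%:C%C * B'.
pose K := 1 + A + B + nrm c3 + nrm c4 + 3 * e.
have [A0 B0 C0 D0] : [/\ 0 <= A, 0 <= B, 0 <= nrm c3 & 0 <= nrm c4].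
  by split; exact: nrm_ge0.
have K0 : 0 < K by rewrite /K; lra.
apply/nbhs0P_real; exists (Num.min 1 (Num.min 1 e / K)).
  by rewrite lt_min ltr01 divr_gt0 // lt_min ltr01.
move=> t; rewrite lt_min ltr_pdivlMr // lt_min => /andP[t1 /andP[tK tKe]] t0 mu.
move: t1 tK tKe; rewrite gtr0_norm // => t1 tK tKe muE mu0.
pose m : C := 1 - a * t%:C%C + B' * t%:C%C ^+ 2.
have nt : nrm (t%:C%C : C) = t by rewrite nrm_real gtr0_norm.
have mE : 1 - t * complex.Re a + (complex.Re (a ^+ 2) - b) * t ^+ 2 = complex.Re m.
  by rewrite /m /B'; case: (a) => x y; rewrite /= !expr2 /=; ring.
rewrite mE.
have t2 : t ^+ 2 <= t by rewrite expr2 -[leRHS]mulr1 ler_wpM2l // ltW.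
have t20 : 0 < t ^+ 2 by rewrite exprn_gt0.
have nexp (w : C) k : nrm (w ^+ k) = nrm w ^+ k.
  by elim: k => [|k IH]; rewrite ?expr0 ?nrm1 // !exprS nrmM IH.
have hm : nrm m <= 2.
  apply: le_trans (nrmD _ _) _.
  have := nrmD (1 : C) (- (a * t%:C%C)); rewrite nrmN nrm1.
  have -> : nrm (a * t%:C%C) = A * t by rewrite nrmM nt.
  have -> : nrm (B' * t%:C%C ^+ 2) = B * t ^+ 2 by rewrite nrmM nexp nt.
  have : B * t ^+ 2 <= B * t by rewrite ler_wpM2l.
  have : t * (A + B) <= t * K by rewrite ler_wpM2l /K ?ltW //; lra.
  lra.
(* Of the constant 3, two come from [e t^2 m] with [nrm m <= 2], and one from the cubic and quartic
   terms. *)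
have hmu : nrm mu * nrm m <= 1 + 3 * e * t ^+ 2.
  rewrite -nrmM.
  have -> : mu * m = 1 + (c3 * t%:C%C ^+ 3 + c4 * t%:C%C ^+ 4 + (e * t ^+ 2)%:C%C * m).
    have tC : (t ^+ 2)%:C%C = t%:C%C ^+ 2 :> C by rewrite rmorphXn.
    have e1 : (t ^+ 2 * (b + e))%:C%C = t%:C%C ^+ 2 * (b%:C%C + e%:C%C) :> C.
      by rewrite -tC -rmorphD -rmorphM.
    have e2 : (e * t ^+ 2)%:C%C = e%:C%C * t%:C%C ^+ 2 :> C by rewrite -tC -rmorphM.
    by rewrite muE /m /c3 /c4 e1 e2 /B'; ring.
  apply: le_trans (nrmD _ _) _; rewrite nrm1 lerD2l.
  apply: le_trans (nrmD _ _) _.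
  apply: le_trans (lerD (nrmD _ _) (lexx _)) _.
  have -> : nrm (c3 * t%:C%C ^+ 3) = nrm c3 * t ^+ 3 by rewrite nrmM nexp nt.
  have -> : nrm (c4 * t%:C%C ^+ 4) = nrm c4 * t ^+ 4 by rewrite nrmM nexp nt.
  rewrite nrmM nrm_real gtr0_norm ?mulr_gt0 //.
  have h1 : e * t ^+ 2 * nrm m <= e * t ^+ 2 * 2 by rewrite ler_wpM2l // mulr_ge0 // ltW.
  have h2 : nrm c3 * t ^+ 3 + nrm c4 * t ^+ 4 <= e * t ^+ 2.
    have h3 : t * (nrm c3 + nrm c4) <= t * K by rewrite ler_wpM2l /K ?ltW //; lra.
    have h4 : nrm c4 * t ^+ 4 <= nrm c4 * t ^+ 3.
      by rewrite ler_wpM2l // [t ^+ 4]exprS -[leRHS]mul1r ler_wpM2r ?exprn_ge0 // ltW.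
    have h5 : t * (nrm c3 + nrm c4) * t ^+ 2 <= e * t ^+ 2.
      by rewrite ler_wpM2r // ltW //; apply: le_lt_trans tKe.
    apply: le_trans h5; rewrite mulrAC -exprS; lra.
  lra.
have nm0 : 0 < nrm mu by rewrite nrm_gt0.
apply: le_trans (lerB (Re_le_nrm m) (lexx _)) _.
rewrite -[leRHS]mul1r ler_pdivlMr //.
have et0 : 0 < e * t ^+ 2 by rewrite mulr_gt0.
(* If [nrm mu] is at least 1/2, subtracting [6 * e * t ^+ 2] absorbs the error [3 * e * t ^+ 2];
   below 1/2, [nrm m <= 2] already makes the product at most 1. *)
have [h|h] := leP (1 / 2) (nrm mu).
  have : 1 / 2 * (e * t ^+ 2) <= nrm mu * (e * t ^+ 2) by rewrite ler_wpM2r // ltW.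
  by lra.
have : nrm mu * nrm m <= nrm mu * 2 by rewrite ler_wpM2l // ltW.
have : 0 < nrm mu * (e * t ^+ 2) by rewrite mulr_gt0.
by lra.
Qed.

End Scalar.

(** * The defining function near a nearest complement point *)

Section Geometry.
Variables (R : realType) (n : nat).
Local Notation C := R[i].
Local Notation Cn := 'rV[C]_n.
Variables (U V : set Cn) (f : Cn -> R) (q : Cn).
Hypothesis (hdef : local_defining U q V f) (hC2 : C2 V f) (Uq : ~ U q).

Lemma defining_ge0 z : V z -> ~ U z -> 0 <= f z.
Proof.
have [oV Vq UV] := hdef; move=> Vz nU; rewrite leNgt; apply/negP => h.
by have [] : (U `&` V) z by rewrite UV.
Qed.

(** Along this curve the first-order term of [f] vanishes and the coefficient of [t^2] is positive.
    Half of it survives the Taylor error, and [f q >= 0], so [f] is positive on the curve while it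
    is negative on [U] near [q]. *)
Lemma near_exterior (c w : Cn) : dform f q c = 0 ->
  0 < hess f q c / 2 + dform f q w ->
  \forall t \near (0:R), 0 < t -> ~ U (q + t%:C%C *: c + (t ^+ 2)%:C%C *: w).
Proof.
have [oV Vq UV] := hdef; move=> c0; set k := (X in 0 < X) => k0.
have k20 : 0 < k / 2 by rewrite divr_gt0.
have hV : \forall t \near (0:R), V (q + t%:C%C *: c + (t ^+ 2)%:C%C *: w).
  move: (oV); rewrite openE => /(_ _ Vq) /nbhs_nrmP[r r0 h].
  pose K := 1 + nrm c + nrm w.
  have [nc nw] : 0 <= nrm c /\ 0 <= nrm w by split; exact: nrm_ge0.
  have K0 : 0 < K by rewrite /K; lra.
  apply/nbhs0P_real; exists (Num.min 1 (r / K)).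
    by rewrite lt_min ltr01 divr_gt0.
  move=> t; rewrite lt_min ltr_pdivlMr // => /andP[t1 tK]; apply: h.
  rewrite -[q + _ + _]addrA addrAC subrr add0r; apply: le_lt_trans (nrmD _ _) _.
  rewrite !nrmZ !nrm_real normrX; apply: le_lt_trans tK.
  have : `|t| ^+ 2 * nrm w <= `|t| * nrm w.
    by rewrite ler_wpM2r // expr2 -[leRHS]mulr1 ler_wpM2l // ltW.
  by rewrite /K; have := normr_ge0 t; lra.
have := taylor2_curve (rcoord c) (rcoord w) oV Vq (C2_rbasis hC2) k20.
apply: filterS2 hV => t Vt + t0 Ut => /(_ t0).
rewrite !comb_rcoord -!/(dform _ _ _) -/(hess _ _ _) c0 mulr0 addr0 -/k.
have := defining_ge0 Vq Uq.
have : f (q + t%:C%C *: c + (t ^+ 2)%:C%C *: w) < 0.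
  have [] // : (V `&` [set z | f z < 0]) (q + t%:C%C *: c + (t ^+ 2)%:C%C *: w).
  by rewrite -UV.
have : 0 < k * t ^+ 2 by rewrite mulr_gt0 // exprn_gt0.
by lra.
Qed.

Variable p : Cn.
Hypothesis (nearest : forall q', ~ U q' -> nrm (p - q) <= nrm (p - q')).
Hypothesis (pq : 0 < nrm (p - q)) (grad : gradient f q != 0).

(* The open ball of radius |p - q| around p lies in U, so f decreases to first
   order along every v pointing from q into it; this works for any norm. *)
Lemma inward_le0 (v : Cn) : nrm (v - (p - q)) < nrm (p - q) -> dform f q v <= 0.
Proof.
move=> hv; rewrite leNgt; apply/negP => h.
have [oV Vq UV] := hdef.
have hd := is_derive_rline_comb (rcoord v) oV Vq (CkS (C2_rbasis hC2)).
rewrite comb_rcoord in hd.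
have hn := first_derivative_test hd h.
have /nbhs0P_real[d d0 hd2] := near_rline v oV Vq.
have /nbhs0P_real[d' d'0 hn2] := hn.
pose t := Num.min (1 / 2) (Num.min (d / 2) (d' / 2)).
have t0 : 0 < t by rewrite !lt_min !divr_gt0.
have [t1 td td'] : [/\ t <= 1 / 2, t <= d / 2 & t <= d' / 2].
  by rewrite /t !ge_min !lexx !orbT.
have td2 : `|t| < d by rewrite gtr0_norm //; lra.
have td'2 : `|t| < d' by rewrite gtr0_norm //; lra.
have Vt := hd2 t td2.
have := hn2 t td'2 t0; rewrite rline0 /rline => hf.
have Ut : U (q + t%:C%C *: v).
  apply: contrapT => /nearest.
  apply/negP; rewrite -ltNge.
  have -> : p - (q + t%:C%C *: v) = (1 - t)%:C%C *: (p - q) - t%:C%C *: (v - (p - q)).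
    rewrite opprD addrA; move: (p - q) => x.
    by rewrite rmorphB /= scalerBl scale1r scalerBr opprB addrA subrK.
  apply: le_lt_trans (nrmD _ _) _.
  rewrite nrmN !nrmZ !nrm_real gtr0_norm ?(gtr0_norm t0); last by lra.
  have : t * nrm (v - (p - q)) < t * nrm (p - q) by rewrite ltr_pM2l.
  by lra.
have : f (q + t%:C%C *: v) < 0.
  by have [] : (V `&` [set z | f z < 0]) (q + t%:C%C *: v) by rewrite -UV.
have := defining_ge0 Vq Uq.
by lra.
Qed.

(** [inward_le0] at [p - q] itself would give only a weak inequality. Applying it to [p - q] plus a
    small multiple of a vector on which the differential is positive makes it strict. *)
Lemma outward_gt0 : 0 < dform f q (q - p).
Proof.
have [e e0] := dform_gt0 grad.
have ne : 0 < 1 + nrm e by rewrite ltr_wpDr // nrm_ge0.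
pose s := nrm (p - q) / (1 + nrm e).
have s0 : 0 < s by rewrite divr_gt0.
have := @inward_le0 (s%:C%C *: e + (p - q)).
rewrite addrK nrmZ nrm_real gtr0_norm // => h0.
have h : s * dform f q e + dform f q (p - q) <= 0.
  rewrite -dformZ -dformD; apply: h0; rewrite /s mulrAC ltr_pdivrMr // ltr_pM2l //; lra.
have : 0 < s * dform f q e by rewrite mulr_gt0.
have -> : q - p = (-1)%:C%C *: (p - q) by rewrite rmorphN scaleN1r opprB.
by rewrite dformZ; lra.
Qed.

End Geometry.

(** * Submean inequalities for the exhaustion and the conclusion *)

Section Exhaustion.
Variables (R : realType) (n : nat).
Local Notation C := R[i].
Local Notation Cn := 'rV[C]_n.

Lemma hessN (f : Cn -> R) (q v : Cn) : hess f q (- v) = hess f q v.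
Proof.
have rN i : rcoord (- v) i = - rcoord v i.
  by case: i => j /=; rewrite mxE; case: (v 0 j).
apply: eq_bigr => i _; rewrite rN mulNr -mulrN -sumrN; congr (_ * _).
by apply: eq_bigr => j _; rewrite rN mulNr opprK.
Qed.

(** The complement point used is [q + t c + t^2 (b + e) (q - p)], where the extra [e] turns the weak
    second-order inequality into the strict one of [near_exterior]. Its difference from [p + t d] is
    a scalar multiple of [p - q], so the bound reduces to [inv_nrm_ge]. *)
Lemma inv_dist_ge (U V : set Cn) (f dist : Cn -> R) (p q d c : Cn) (a : C) (b e : R) :
  open U -> U p -> local_defining U q V f -> C2 V f -> ~ U q ->
  0 < nrm (p - q) ->
  (forall x y, ~ U y -> dist x <= nrm (x - y)) -> (forall x, U x -> 0 < dist x) ->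
  c = d + a *: (q - p) -> dform f q c = 0 ->
  0 <= hess f q c / 2 + b * dform f q (q - p) -> 0 < dform f q (q - p) -> 0 < e ->
  \forall t \near (0:R), 0 < t ->
    (1 - t * complex.Re a + (complex.Re (a ^+ 2) - b) * t ^+ 2 - 6 * e * t ^+ 2)
      / nrm (p - q) <= (dist (p + t%:C%C *: d))^-1.
Proof.
move=> oU Up hdef hC2 Uq pq hdist dist0 cE c0 hb nu0 e0.
have := near_exterior (w := (b + e)%:C%C *: (q - p)) hdef hC2 Uq c0.
rewrite dformZ => hext.
have {}hext := hext _; have {hext} hext : \forall t \near (0:R), 0 < t ->
    ~ U (q + t%:C%C *: c + (t ^+ 2)%:C%C *: ((b + e)%:C%C *: (q - p))).
  by apply: hext; have : 0 < e * dform f q (q - p) by [rewrite mulr_gt0]; lra.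
have h1 := inv_nrm_ge a b e0; have h2 := near_rline d oU Up.
near=> t; move=> t0.
have ht : ~ U (q + t%:C%C *: c + (t ^+ 2)%:C%C *: ((b + e)%:C%C *: (q - p))).
  by move: t0; near: t.
have Ut : U (p + t%:C%C *: d) by near: t.
pose mu : C := 1 + t%:C%C * a + (t ^+ 2 * (b + e))%:C%C.
have key : mu != 0 -> 1 - t * complex.Re a + (complex.Re (a ^+ 2) - b) * t ^+ 2
    - 6 * e * t ^+ 2 <= (nrm mu)^-1.
  have : 0 < t -> forall mu : C, mu = 1 + t%:C%C * a + (t ^+ 2 * (b + e))%:C%C -> mu != 0 ->
    1 - t * complex.Re a + (complex.Re (a ^+ 2) - b) * t ^+ 2 - 6 * e * t ^+ 2
    <= (nrm mu)^-1 by near: t.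
  by move=> /(_ t0 mu erefl).
have := hdist (p + t%:C%C *: d) _ ht.
rewrite (_ : _ - _ = mu *: (p - q)); last first.
  rewrite -[p - q]opprB cE /mu; move: (q - p) (subrK p q) => x <-.
  apply/rowP => j; rewrite !mxE rmorphM /=; ring.
rewrite nrmZ => hle.
have d0 := dist0 _ Ut.
(* The factor [mu] cannot vanish, because [p + t d] lies in [U] and so has positive distance. *)
have m0 : 0 < nrm mu by rewrite -(pmulr_lgt0 _ pq); exact: lt_le_trans hle.
have mu0 : mu != 0 by rewrite -nrm_gt0.
apply: le_trans (_ : (nrm mu)^-1 / nrm (p - q) <= _).
  by rewrite ler_wpM2r ?key // invr_ge0 ltW.
by rewrite -invfM lef_pV2 // posrE mulr_gt0.
Unshelve. all: by end_near. Qed.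

Lemma cross_submean_inv_dist (U : set Cn) (dist : Cn -> R) (p d : Cn) :
  open U -> levi_pseudoconvex U -> U p ->
  (forall x y, ~ U y -> dist x <= nrm (x - y)) ->
  (forall x, exists2 y, ~ U y & dist x = nrm (x - y)) ->
  cross_submean (fun z => (dist z)^-1) p d.
Proof.
move=> oU levi Up hdist hnear e e0.
have dist0 x : U x -> 0 < dist x.
  move=> Ux; have [y nUy ->] := hnear x; rewrite nrm_gt0 subr_eq0.
  by apply: contra_notN nUy => /eqP <-.
have [q Uq dpq] := hnear p.
have pq : 0 < nrm (p - q) by rewrite -dpq dist0.
have nearest q' : ~ U q' -> nrm (p - q) <= nrm (p - q') by rewrite -dpq; exact: hdist.
(* Points of the segment from [q] towards [p] are closer to [p] than [q] is, hence lie in [U]; they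
   accumulate at [q]. *)
have bq : boundary U q.
  split; last by move=> /interior_subset.
  move=> B /nbhs_nrmP[r r0 hB].
  pose t := Num.min (1 / 2) (r / 2 / (1 + nrm (p - q))).
  have t0 : 0 < t by rewrite lt_min !divr_gt0 //; lra.
  have [t1 tr] : t <= 1 / 2 /\ t <= r / 2 / (1 + nrm (p - q)).
    by rewrite /t !ge_min !lexx orbT.
  exists (q + t%:C%C *: (p - q)); split.
    apply: contrapT => /nearest; apply/negP; rewrite -ltNge.
    rewrite (_ : _ - (_ + _) = (1 - t)%:C%C *: (p - q)); last first.
      by rewrite opprD addrA rmorphB /= scalerBl scale1r.
    rewrite nrmZ nrm_real gtr0_norm; last by lra.
    by rewrite gtr_pMl //; lra.
  apply: hB; rewrite addrAC subrr add0r nrmZ nrm_real gtr0_norm //.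
  move: tr; rewrite ler_pdivlMr; last by lra.
  by rewrite mulrDr; lra.
have [V [f [[hdef hC2 grad _] hlevi]]] := levi q bq.
have nu0 := outward_gt0 hdef hC2 Uq nearest pq grad.
have cnu : cform f q (q - p) != 0.
  by apply: contraTneq nu0; rewrite dform_Re => ->; rewrite mulr0 ltxx.
pose a := - cform f q d / cform f q (q - p).
pose v := d + a *: (q - p).
have v0 : cform f q v = 0 by rewrite cformD cformZ divfK // subrr.
have cZ (w : C) : dform f q (w *: v) = 0 by rewrite dform_Re cformZ v0 mulr0 mulr0.
have hd i j : rderivable (rderive (@rbasis R n i) f) q (@rbasis R n j).
  have [_ /(_ _ (ex_intro2 _ _ i Logic.I erefl))[_ [_]]] := C2_rbasis hC2.
  by move=> /(_ _ (ex_intro2 _ _ j Logic.I erefl))[h _]; apply: h; case: hdef.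
have Q0 : 0 <= hess f q v + hess f q ('i%C *: v).
  rewrite -(levi_form_hess v hd) mulr_ge0 //.
  by have := hlevi v v0; rewrite lecE => /andP[].
set D := dform f q (q - p) in nu0.
(* At the four points [s^2] is [t^2] or [-t^2], so [b] is taken real. This value makes both
   [hess v / 2 + b D] and [hess (i v) / 2 - b D] equal to [(hess v + hess (i v)) / 4], the real part
   of the Levi form at [v]. *)
pose b := (hess f q ('i%C *: v) - hess f q v) / (4 * D).
have bD : b * D = (hess f q ('i%C *: v) - hess f q v) / 4.
  by rewrite /b; field; rewrite gt_eqF.
pose r := nrm (p - q).
(* Each of the four points loses [6 * e' * t ^+ 2 / r]; together this is [e * t ^+ 2]. *)
pose e' := e * r / 24.
have e'0 : 0 < e' by rewrite divr_gt0 ?mulr_gt0.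
have H (w : C) (b' : R) : 0 <= hess f q (w *: v) / 2 + b' * D ->
    \forall t \near (0:R), 0 < t ->
    (1 - t * complex.Re (w * a) + (complex.Re ((w * a) ^+ 2) - b') * t ^+ 2
      - 6 * e' * t ^+ 2) / r <= (dist (p + t%:C%C *: (w *: d)))^-1.
  move=> hb; apply: (inv_dist_ge oU Up hdef hC2 Uq pq hdist dist0 _ (cZ w) hb nu0 e'0).
  by rewrite /v scalerDr scalerA.
have H1 := H 1 b _; have H2 := H (-1) b _.
have H3 := H 'i%C (- b) _; have H4 := H (- 'i%C) (- b) _.
rewrite ?scaleN1r ?scale1r ?scaleNr ?hessN in H1 H2 H3 H4.
have {}H1 := H1 ltac:(lra); have {}H2 := H2 ltac:(lra).
have {}H3 := H3 ltac:(lra); have {}H4 := H4 ltac:(lra).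
apply: filterS2 (filterI H1 H2) (filterI H3 H4) => t [K1 K2] [K3 K4] t0.
move: {H1 H2 H3 H4} (lerD (lerD (lerD (K1 t0) (K2 t0)) (K3 t0)) (K4 t0)).
rewrite -!mulrDl; set S := (X in X / r).
(* Over [w = 1, -1, i, -i] the sums of [w a], of [(w a)^2] and of the signed [b] all vanish. *)
rewrite (_ : S = 4 - 24 * e' * t ^+ 2); last first.
  by rewrite /S; case: (a) => x y; rewrite !expr2 /=; ring.
rewrite /cross_sum /rline rmorphN !scalerN !scaleNr dpq -/r.
rewrite (_ : (4 - 24 * e' * t ^+ 2) / r = 4 / r - e * t ^+ 2) //.
by rewrite /e'; field; rewrite gt_eqF.
Qed.

(** The four points sum to [4 p], so the triangle inequality gives the bound for every [t], even
    without the error term. *)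
Lemma cross_submean_nrm (p d : Cn) : cross_submean (@nrm R Cn) p d.
Proof.
move=> e e0; near=> t; move=> t0.
apply: le_trans (_ : 4 * nrm p <= _); first by rewrite gerBl mulr_ge0 ?sqr_ge0 // ltW.
have -> : 4 * nrm p = nrm ((p + t%:C%C *: d) + (p + (- t)%:C%C *: d) +
    (p + t%:C%C *: ('i%C *: d)) + (p + (- t)%:C%C *: ('i%C *: d))).
  rewrite rmorphN !scaleNr /= (_ : _ + _ = (4%:R)%:C%C *: p).
    by rewrite nrmZ nrm_real ger0_norm.
  apply/rowP => j; rewrite !mxE rmorph_nat; ring.
apply: le_trans (nrmD _ _) _; rewrite lerD2r.
by apply: le_trans (nrmD _ _) _; rewrite lerD2r; exact: nrmD.
Unshelve. all: by end_near. Qed.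

(** The function attaining the maximum at [p] supplies the inequality, and passing to the maximum
    only raises its four-point sum. *)
Lemma cross_submean_max (f g : Cn -> R) (p d : Cn) :
  cross_submean f p d -> cross_submean g p d -> cross_submean (f \max g) p d.
Proof.
move=> hf hg e e0.
apply: filterS2 (hf e e0) (hg e e0) => t ht1 ht2 t0.
have {}ht1 := ht1 t0; have {}ht2 := ht2 t0.
have le1 x : f x <= Num.max (f x) (g x) by rewrite le_max lexx.
have le2 x : g x <= Num.max (f x) (g x) by rewrite le_max lexx orbT.
rewrite /cross_sum /rline /= in ht1 ht2 *.
have [h|h] := leP (g p) (f p); rewrite ?(max_l h) ?(max_r (ltW h)).
  by apply: le_trans ht1 _; rewrite !lerD.
by apply: le_trans ht2 _; rewrite !lerD.
Qed.

Lemma plurisubharmonic_cross (U : set Cn) (f : Cn -> R) :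
  (forall z, U z -> {for z, continuous f}) ->
  (forall z d, U z -> cross_submean f z d) ->
  plurisubharmonic U (fun z => (f z)%:E).
Proof.
move=> cf hf; split; first exact: continuous_usc.
move=> a d Ua _; apply: (@subharmonic_cross R _ (fun z => f (a + z *: d))) => z Uz.
  apply/continuous_at_nrmP => e e0.
  have [r r0 hr] := (continuous_at_nrmP _ _).1 (cf _ Uz) e e0.
  have nd : 0 < 1 + nrm d by rewrite ltr_wpDr // nrm_ge0.
  exists (r / (1 + nrm d)) => [|y]; first by rewrite divr_gt0.
  rewrite ltr_pdivlMr // => hy; apply: hr; apply: le_lt_trans hy.
  by rewrite opprD addrACA subrr add0r -scalerBl nrmZ ler_wpM2l ?nrm_ge0 // lerDr.
move=> e e0; apply: filterS (hf _ d Uz e e0) => t ht /ht.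
congr (_ <= _); rewrite /cross_sum /rline.
have h (s : R) (w : C) : a + (z + s%:C%C *: w) *: d = a + z *: d + s%:C%C *: (w *: d).
  by rewrite scalerDl -scalerA addrA.
by rewrite !h -[_ *: 1]/(_ * 1) mulr1 scale1r.
Qed.

End Exhaustion.

Theorem theorem4p30 (R : realType) (n : nat) (U : set 'rV[R[i]]_n)
    (hU : domain U) (hC2 : has_C2_boundary U) (hLevi : levi_pseudoconvex U) :
  pseudoconvex U.
Proof.
have [oU _] := hU.
have compact_ball (r : R) : compact [set x : 'rV[R[i]]_n | nrm x <= r].
  have := @compact_nrm_ball R n 0 r; congr compact.
  by apply/seteqP; split => x /=; rewrite subr0.
(* If [U] is the whole space there is no complement to measure the distance to, and the norm alone
   is an exhaustion. *)
have [nU|Uall] := pselect (exists x, ~ U x); last first.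
  have {}Uall x : U x by apply: contrapT => h; apply: Uall; exists x.
  exists (@nrm R 'rV[R[i]]_n); split.
  - apply: continuous_subspaceT; exact: continuous_nrm.
  - apply: plurisubharmonic_cross => [z _|z d _]; first exact: continuous_nrm.
    exact: cross_submean_nrm.
  - move=> r; rewrite (_ : U = setT) ?setTI; first exact: compact_ball.
    by apply/seteqP; split.
have cU : closed (~` U) by exact: open_closedC.
have /choice[dist hd] : forall p, exists s : R, (exists2 q, ~ U q & s = nrm (p - q)) /\
    forall q, ~ U q -> s <= nrm (p - q).
  move=> p; have [q Uq hq] := nearest_point p cU nU.
  by exists (nrm (p - q)); split=> //; exists q.
have hnear x := (hd x).1; have hdist x := (hd x).2.
have dist0 x : U x -> 0 < dist x.
  move=> Ux; have [y nUy ->] := hnear x; rewrite nrm_gt0 subr_eq0.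
  by apply: contra_notN nUy => /eqP <-.
have cdist : continuous dist.
  apply: continuous_lipschitz => x y; have [q Uq ->] := hnear y.
  apply: le_trans (hdist x q Uq) _.
  by rewrite [leRHS]addrC; apply: le_trans (nrmD _ _); rewrite addrA subrK.
pose f := (fun x => (dist x)^-1) \max (@nrm R 'rV[R[i]]_n).
have cf x : U x -> {for x, continuous f}.
  move=> Ux; apply: continuous_max; last exact: continuous_nrm.
  by apply: continuousV; [rewrite gt_eqF // dist0|exact: cdist].
exists f; split.
- by apply: continuous_in_subspaceT => x /set_mem; exact: cf.
- apply: plurisubharmonic_cross => // z d Uz; apply: cross_submean_max.
    exact: (cross_submean_inv_dist _ oU hLevi Uz).
  exact: cross_submean_nrm.
(* For [r <= 0] the sublevel set is empty, since [1 / dist] is positive on [U]. For [r > 0] it is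
   cut out of a compact ball by the closed condition [r^-1 <= dist], which already forces membership
   in [U] because [dist <= 0] off [U]. *)
- move=> r; have [r0|r0] := leP r 0.
    rewrite (_ : _ `&` _ = set0); first exact: compact0.
    apply/seteqP; split => // x [Ux] /=; rewrite /f ge_max => /andP[h _].
    have : 0 < (dist x)^-1 by rewrite invr_gt0 dist0.
    by rewrite ltNge (le_trans h r0).
  rewrite (_ : _ `&` _ = [set x | nrm x <= r] `&` [set x | r^-1 <= dist x]).
    apply: compact_closedI; first exact: compact_ball.
    apply: (@preimage_closed _ _ dist [set y | r^-1 <= y]); last exact: closed_ge.
    by move=> x _; exact: cdist.
  apply/seteqP; split => x /=.
    move=> [Ux]; rewrite /f ge_max => /andP[h ->]; split=> //.
    by rewrite -[leRHS]invrK lef_pV2 // posrE ?invr_gt0 // dist0.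
  move=> [h1 h2]; have d0 : 0 < dist x by apply: lt_le_trans h2; rewrite invr_gt0.
  split; last by rewrite /f ge_max h1 andbT -[leRHS]invrK lef_pV2 // posrE ?invr_gt0.
  apply: contrapT => /(hdist x); rewrite subrr nrm0 leNgt => /negP; exact.
Qed.
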